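(* Let $G\in L^2(\gamma)$, let $D\subset\mathbb{R}^p$ be an open region (connected open set) containing the origin $\mathbf{0}=(0,\ldots,0)$, and let $\{F_\theta\}_{\theta\in D}$ be a family of transformations $F_\theta:\mathbb{R}\to\mathbb{R}$ parameterized by $\theta\in D$ such that $F_{\mathbf 0}$ is the identity transformation. Assume that $G\circ F_\theta\in L^2(\gamma)$ for all $\theta\in D$. Let $Z$ be a standard normal random variable and let $$U(\theta):=\mathbb{E}\big[(G\circ F_\theta)(Z)\,H_1(Z)\big]=\mathbb{E}\big[(G\circ F_\theta)(Z)\,Z\big],\qquad \theta\in D.$$ Assume that: (a) $U(\theta)$ is real analytic in $\theta\in D$; (b) if $U(\theta)=0$ for all $\theta\in D$, then $G$ is constant a.e. Then either $G$ is constant a.e., or, if not, the set $$E=\{\theta\in D:\ G\circ F_\theta\text{ has Hermite rank}\ \ge2\}=\{\theta\in D:\ U(\theta)=0\}$$ has Hausdorff dimension not exceeding $p-1$. In particular, in the latter case $E$ has zero $p$-dimensional Lebesgue measure.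
   Context: $\gamma(dx)=\phi(x)\,dx$ with $\phi(x)=(2\pi)^{-1/2}e^{-x^2/2}$ is the standard Gaussian measure on $\mathbb{R}$, and $L^2(\gamma)=L^2(\phi)=\{G:\mathbb{R}\to\mathbb{R}\ \text{measurable}:\int_{\mathbb{R}}G(z)^2\phi(z)\,dz<\infty\}$. ''a.e.'' is with respect to Lebesgue measure. The Hermite polynomials are $H_0(x)=1$ and $H_m(x)=(-1)^m e^{x^2/2}\frac{d^m}{dx^m}e^{-x^2/2}$ for $m\ge1$ (so $H_1(x)=x$). The Hermite rank of $f\in L^2(\gamma)$ is $\inf\{m\ge 1:\int_{\mathbb{R}} f(x)H_m(x)\,\gamma(dx)\ne 0\}$ (with $\inf\emptyset=\infty$). *)

(* Defs.v *)
From HB Require Import structures.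
From mathcomp Require Import all_boot all_order all_algebra.
From mathcomp Require Import ring.
From mathcomp Require Import all_classical all_reals all_analysis.

Set Implicit Arguments.
Unset Strict Implicit.
Unset Printing Implicit Defensive.
Import Order.TTheory GRing.Theory Num.Theory.
Import numFieldNormedType.Exports.

Local Open Scope classical_set_scope.
Local Open Scope ring_scope.

Notation gaussian R := (@normal_prob R 0 1).

Section hermite.
Context {R : realType}.
Implicit Types (f G : R -> R) (x : R).

Definition const_ae G := exists c : R, {ae @lebesgue_measure R, forall x, G x = c}.

Definition hermite (m : nat) x : R :=
  (-1) ^+ m * expR (x ^+ 2 / 2) * derive1n m (fun y : R => expR (- (y ^+ 2 / 2))) x.

Lemma hermite0 x : hermite 0 x = 1.
Proof. by rewrite /hermite expr0 mul1r derive1n0 -expRD subrr expR0. Qed.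

Lemma hermite1 x : hermite 1 x = x.
Proof.
have hq : is_derive x 1 (fun y : R => - (y ^+ 2 / 2)) (- x).
  rewrite (_ : (fun y : R => - (y ^+ 2 / 2)) = (- 2^-1) *: (id ^+ 2)); last first.
    by apply/funext => y; rewrite mulrC -mulNr.
  by apply: is_derive_eq; rewrite /GRing.scale/= expr1; field.
have he : is_derive x 1 (fun y : R => expR (- (y ^+ 2 / 2)))
    (expR (- (x ^+ 2 / 2)) * - x).
  exact: (@is_derive1_comp R expR (fun y : R => - (y ^+ 2 / 2))).
rewrite /hermite derive1n1 derive1E derive_val expr1.
by rewrite mulrA -(mulrA (-1)) -expRD subrr expR0; ring.
Qed.

(* With value in the extended reals, so that the rank is [+oo] when no
   Hermite coefficient of positive order survives. *)
Definition hermite_rank f : \bar R :=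
  ereal_inf [set m%:R%:E | m in [set m : nat | (1 <= m)%N /\
    (\int[gaussian R]_x (f x * hermite m x)%:E)%E <> 0%E]].

End hermite.

Section euclidean.
Context {R : realType} {p : nat}.
Implicit Types (f : 'rV[R]_p -> R) (x y c : 'rV[R]_p) (A D : set 'rV[R]_p).

(* [f] is real analytic on [D] when near each point of [D] it is the sum of an
   absolutely convergent power series in [p] variables; [alpha] ranges over
   multi-indices.  The sum of an absolutely summable family is the sum of its
   positive parts minus the sum of its negative parts. *)
Definition power_term (a : {ffun 'I_p -> nat} -> R) c x
    (alpha : {ffun 'I_p -> nat}) : \bar R :=
  (a alpha * \prod_(i < p) (x 0 i - c 0 i) ^+ alpha i)%:E.

Definition is_power_sum (a : {ffun 'I_p -> nat} -> R) c x (v : R) :=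
  summable setT (power_term a c x) /\
  v%:E = (esum setT (power_term a c x)^\+ - esum setT (power_term a c x)^\-)%E.

Definition real_analytic D f :=
  forall c, D c -> exists a : {ffun 'I_p -> nat} -> R,
    \forall x \near c, is_power_sum a c x (f x).

(* The library norm on ['rV_p] is the sup norm. *)
Definition euclid_dist x y : R := Num.sqrt (\sum_(i < p) (x 0 i - y 0 i) ^+ 2).

Definition diam A : \bar R :=
  ereal_sup [set (euclid_dist x y)%:E | x in A & y in A].

(* [diam A ^ s], with value 0 on the empty set also when [s = 0]. *)
Definition diam_pow (s : R) A : \bar R :=
  if `[< A = set0 >] then 0%E else (diam A `^ s)%E.

Definition hausdorff_premeasure (s delta : R) A : \bar R :=
  ereal_inf [set (\sum_(k <oo) diam_pow s (V k))%E |
    V in [set V : (set 'rV[R]_p)^nat |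
      A `<=` \bigcup_k V k /\ forall k, (diam (V k) <= delta%:E)%E]].

Definition hausdorff_measure (s : R) A : \bar R :=
  ereal_sup [set hausdorff_premeasure s delta A |
    delta in [set delta : R | 0 < delta]].

Definition hausdorff_dim A : \bar R :=
  ereal_inf [set s%:E | s in [set s : R | 0 <= s /\ hausdorff_measure s A = 0%E]].

Definition box x y : set 'rV[R]_p :=
  [set z | forall i, x 0 i <= z 0 i <= y 0 i].

(* The [p]-dimensional Lebesgue outer measure; it extends Lebesgue measure, and
   the sets of Lebesgue measure zero are those where it vanishes. *)
Definition lebesgue_outer A : \bar R :=
  ereal_inf [set (\sum_(k <oo) (\prod_(i < p) ((V k).2 0 i - (V k).1 0 i))%:E)%E |
    V in [set V : ('rV[R]_p * 'rV[R]_p)^nat |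
      A `<=` \bigcup_k box (V k).1 (V k).2 /\
      forall k i, (V k).1 0 i <= (V k).2 0 i]].

End euclidean.

Definition U_coef d (T : measurableType d) (R : realType) (P : probability T R)
    (Z : T -> R) (p : nat) (G : R -> R) (F : 'rV[R]_p -> R -> R)
    (theta : 'rV[R]_p) : R :=
  fine 'E_P[fun w => (G \o F theta) (Z w) * hermite 1 (Z w)].

Lemma U_coefE d (T : measurableType d) (R : realType) (P : probability T R)
    (Z : T -> R) (p : nat) (G : R -> R) (F : 'rV[R]_p -> R -> R)
    (theta : 'rV[R]_p) :
  U_coef P Z G F theta = fine 'E_P[fun w => (G \o F theta) (Z w) * Z w].
Proof.
by congr (fine (expectation P _)); apply/funext => w; rewrite hermite1.
Qed.

(* Main.v *)
Require Import Defs.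
From HB Require Import structures.
From mathcomp Require Import all_boot all_order all_algebra.
From mathcomp Require Import ring lra.
From mathcomp Require Import all_classical all_reals all_analysis.
From mathcomp Require Import measurable_realfun.
Import Order.TTheory GRing.Theory Num.Theory.
Import numFieldNormedType.Exports.
Local Open Scope classical_set_scope.
Local Open Scope ring_scope.

(** The theorem has a probabilistic half and a geometric half.

    The probabilistic half is that [E] is the zero set of [U].  Having Hermite
    rank at least 2 means that the coefficient against [H_1 x = x] vanishes,
    and that coefficient is [U theta] because [Z] has law [gamma].  As [U] is
    the finite part of an extended-real expectation, one must know that the
    expectation is finite; it is, since [G \o F theta] and [x] both lie in
    [L^2(gamma)] ([id_Lfun2_gaussian], [hermite_rank_ge2_U_coef]).

    The geometric half is that the zero set of a real analytic function on a
    connected open [D], not identically zero there, has dimension at most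
    [p - 1] ([real_analytic_zero_set]).  Hypothesis (b) says exactly that [U]
    is not identically zero when [G] is not constant.

    Locally, expand the function around [c] and pick a multi-index [alpha]
    whose coefficient is nonzero.  Differentiating formally, one coordinate at
    a time, leads from [g_0 = f] to a function [g_n] with [g_n c != 0], hence
    with no zero near [c].  A zero of [f] near [c] is thus, for some [k], a
    zero of [g_k] at which [g_{k+1}], a partial derivative of [g_k], does not
    vanish.  Near such a point, the zeros of [g_k] form a sheet: the
    coordinate in the direction of differentiation is a Lipschitz function of
    the others.  A bounded sheet meets each of the [N^(p-1)] columns of a grid
    of step [1/N] in a set of size [O(1/N)], so it is covered by [N^(p-1)]
    cubes of that size, and for [s > p - 1] the sum of the [s]-th powers of
    their sides tends to zero ([content_null_sheet]).  This is an induction on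
    the degree of [alpha] ([zero_set_local]), which also shows that [f]
    vanishes on no open set near [c].  The last fact makes the set of points
    near which [f] vanishes closed in [D]; it is open, so it is empty by
    connectedness, and a Lindelof argument ([content_null_local]) passes from
    local to global.

    Sets with arbitrarily economical covers by cubes have both zero Hausdorff
    measure in dimension [s] and, for [s = p], zero Lebesgue measure
    ([content_null_hausdorff], [content_null_lebesgue]), so one notion serves
    the two conclusions.

    No partial derivative is ever taken as a limit: it is the series of the
    formally differentiated terms.  What links it to the function is
    [power_series_taylor2], which, like [power_series_lip], follows term by
    term from an estimate on monomials. *)

Set Implicit Arguments.
Unset Strict Implicit.
Unset Printing Implicit Defensive.

(** * Absolutely summable families of real numbers *)

Section signed_sums.
Context {R : realType} {T : choiceType}.
Implicit Types (u v M : T -> R).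

Lemma ge0_esumZl (k : R) (f : T -> \bar R) : 0 <= k -> (forall i, 0 <= f i)%E ->
  (\esum_(i in [set: T]) (k%:E * f i) = k%:E * \esum_(i in [set: T]) f i)%E.
Proof.
move=> k0 f0; rewrite /esum -ereal_supZl//; last first.
  by apply/set0P; exists (\sum_(x \in set0) f x)%E; exists set0 => //;
    exact: fsets_set0.
by rewrite image_comp; congr ereal_sup; apply: eq_imagel => A _ /=;
  rewrite ge0_mule_fsumr.
Qed.

Definition abs_summable u := summable [set: T] (EFin \o u).

(** This is the form in which the hypothesis of analyticity defines the sum of
    a family; as a real number it obeys the usual linear calculus. *)
Definition signed_sum u : R :=
  fine (esum setT (EFin \o u)^\+ - esum setT (EFin \o u)^\-)%E.

Lemma abs_summable_le u M :
  (forall i, `|u i| <= M i) -> abs_summable M -> abs_summable u.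
Proof.
move=> uM; apply: le_lt_trans; apply: le_esum => i _ /=.
by rewrite lee_fin (le_trans (uM i))// ler_norm.
Qed.

Lemma abs_summable_norm u : abs_summable u -> abs_summable (fun i => `|u i|).
Proof.
by apply: le_lt_trans; apply: le_esum => i _ /=; rewrite lee_fin normr_id.
Qed.

Lemma abs_summableD u v :
  abs_summable u -> abs_summable v -> abs_summable (fun i => u i + v i).
Proof. by move=> su sv; have := summableD su sv. Qed.

Lemma abs_summableZ k u : abs_summable u -> abs_summable (fun i => k * u i).
Proof.
move=> su; rewrite /abs_summable /summable.
under eq_esum => i _ do rewrite /= normrM EFinM.
rewrite ge0_esumZl//; have : summable [set: T] (EFin \o u) by [].
by rewrite summableE => /fineK <-; rewrite -EFinM ltry.
Qed.

Lemma signed_sum_ge0E u : (forall i, 0 <= u i) -> abs_summable u ->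
  ((signed_sum u)%:E = \esum_(i in [set: T]) (u i)%:E)%E.
Proof.
move=> u0 su; rewrite /signed_sum.
have -> : (esum setT (EFin \o u)^\- = 0)%E.
  rewrite esum1// => i _; rewrite /= funenegE.
  by apply/max_idPr; rewrite /= lee_fin oppr_le0.
have -> : (esum setT (EFin \o u)^\+ = \esum_(i in [set: T]) (u i)%:E)%E.
  apply: eq_esum => i _; rewrite /= funeposE.
  by apply/max_idPl; rewrite /= lee_fin.
rewrite sube0 fineK//; move: su; rewrite /abs_summable summableE.
by under eq_esum => i _ do rewrite /= ger0_norm//.
Qed.

Lemma signed_sum_ge0 u : (forall i, 0 <= u i) -> abs_summable u ->
  0 <= signed_sum u.
Proof.
move=> u0 su; rewrite -lee_fin signed_sum_ge0E//.
by apply: esum_ge0 => i _; rewrite lee_fin.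
Qed.

Lemma signed_sumB_ge0 u v : abs_summable u -> abs_summable v ->
  (forall i, 0 <= u i) -> (forall i, 0 <= v i) ->
  signed_sum (fun i => u i - v i) = signed_sum u - signed_sum v.
Proof.
move=> su sv u0 v0; apply: EFin_inj;
  rewrite EFinB (signed_sum_ge0E u0)// (signed_sum_ge0E v0)//.
rewrite -(@esumB _ _ setT (EFin \o u) (EFin \o v))//; last 2 first.
- by move=> i _; rewrite lee_fin.
- by move=> i _; rewrite lee_fin.
rewrite /signed_sum fineK// fin_numB.
pose w i := u i - v i.
have sw : summable [set: T] (EFin \o w) by have := summableB su sv.
rewrite -/w; apply/andP; split.
  have := summable_funepos sw; rewrite summableE.
  by congr (_ \is a fin_num); apply: eq_esum => i _; rewrite gee0_abs.
have := summable_funeneg sw; rewrite summableE.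
by congr (_ \is a fin_num); apply: eq_esum => i _; rewrite gee0_abs.
Qed.

(** The splitting into [(|u| + u) / 2] and [(|u| - u) / 2] reduces identities on
    signed sums to identities on sums of nonnegative families. *)
Lemma signed_sum_decomp u : abs_summable u -> exists f g,
  [/\ abs_summable f, abs_summable g, forall i, 0 <= f i, forall i, 0 <= g i
    & u = (fun i => f i - g i) /\ forall i, f i + g i = `|u i|].
Proof.
move=> su; exists (fun i => (`|u i| + u i) / 2), (fun i => (`|u i| - u i) / 2).
have ? := abs_summable_norm su.
have b1 (i : T) : 0 <= `|u i| + u i by rewrite -lerBlDr sub0r -normrN ler_norm.
have b2 (i : T) : 0 <= `|u i| - u i by rewrite subr_ge0 ler_norm.
split.
- apply: (@abs_summable_le _ (fun i => `|u i|)) => // i.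
  by rewrite ger0_norm ?divr_ge0//; move: (ler_norm (u i)) => ?; lra.
- apply: (@abs_summable_le _ (fun i => `|u i|)) => // i.
  by rewrite ger0_norm ?divr_ge0//; move: (b1 i) => ?; lra.
- by move=> i; rewrite divr_ge0.
- by move=> i; rewrite divr_ge0.
- by split; [apply/funext => i|move=> i]; field.
Qed.

Lemma signed_sumD_ge0 u v : abs_summable u -> abs_summable v ->
  (forall i, 0 <= u i) -> (forall i, 0 <= v i) ->
  signed_sum (fun i => u i + v i) = signed_sum u + signed_sum v.
Proof.
move=> su sv u0 v0; apply: EFin_inj; rewrite EFinD !signed_sum_ge0E//;
  last 2 first.
- by move=> i; rewrite addr_ge0.
- exact: abs_summableD.
by rewrite -esumD//; move=> i _; rewrite lee_fin.
Qed.

Lemma signed_sumD u v : abs_summable u -> abs_summable v ->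
  signed_sum (fun i => u i + v i) = signed_sum u + signed_sum v.
Proof.
move=> /signed_sum_decomp[f [g [sf sg f0 g0 [-> _]]]]
  /signed_sum_decomp[h [k [suh suk h0 k0 [-> _]]]].
rewrite (_ : (fun i => _) = (fun i => (f i + h i) - (g i + k i))); last first.
  by apply/funext => i; ring.
rewrite (signed_sumB_ge0 (u := fun i => f i + h i) (v := fun i => g i + k i));
  first last.
- by move=> i; rewrite addr_ge0.
- by move=> i; rewrite addr_ge0.
- exact: abs_summableD.
- exact: abs_summableD.
by rewrite (signed_sumB_ge0 sf)// (signed_sumB_ge0 suh)// (signed_sumD_ge0 sf)//
  (signed_sumD_ge0 sg)//; ring.
Qed.

Lemma signed_sumZ_ge0 k u : 0 <= k -> abs_summable u -> (forall i, 0 <= u i) ->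
  signed_sum (fun i => k * u i) = k * signed_sum u.
Proof.
move=> k0 su u0; apply: EFin_inj; rewrite EFinM !signed_sum_ge0E//;
  last 2 first.
- by move=> i; rewrite mulr_ge0.
- exact: abs_summableZ.
by rewrite -ge0_esumZl// => i; rewrite lee_fin.
Qed.

Lemma signed_sumZ k u : abs_summable u ->
  signed_sum (fun i => k * u i) = k * signed_sum u.
Proof.
move=> /signed_sum_decomp[f [g [sf sg f0 g0 [-> _]]]];
  rewrite (signed_sumB_ge0 sf)//.
have [k0|k0] := leP 0 k.
  rewrite (_ : (fun i => _) = (fun i => k * f i - k * g i)); last first.
    by apply/funext => i; ring.
  rewrite (signed_sumB_ge0 (u := fun i => k * f i) (v := fun i => k * g i));
    first last.
  - by move=> i; rewrite mulr_ge0.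
  - by move=> i; rewrite mulr_ge0.
  - exact: abs_summableZ.
  - exact: abs_summableZ.
  by rewrite !signed_sumZ_ge0//; ring.
have Nk0 : 0 <= - k by rewrite oppr_ge0 ltW.
rewrite (_ : (fun i => _) = (fun i => - k * g i - - k * f i)); last first.
  by apply/funext => i; ring.
rewrite (signed_sumB_ge0 (u := fun i => - k * g i) (v := fun i => - k * f i));
  first last.
- by move=> i; rewrite mulr_ge0.
- by move=> i; rewrite mulr_ge0.
- exact: abs_summableZ.
- exact: abs_summableZ.
by rewrite !signed_sumZ_ge0//; ring.
Qed.

Lemma signed_sumB u v : abs_summable u -> abs_summable v ->
  signed_sum (fun i => u i - v i) = signed_sum u - signed_sum v.
Proof.
move=> su sv; rewrite -[in RHS]mulN1r -signed_sumZ// -signed_sumD//;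
  last exact: abs_summableZ.
by congr signed_sum; apply/funext => i; rewrite mulN1r.
Qed.

Lemma ler_signed_sum u v : abs_summable u -> abs_summable v ->
  (forall i, u i <= v i) -> signed_sum u <= signed_sum v.
Proof.
move=> su sv uv; rewrite -subr_ge0 -signed_sumB//; apply: signed_sum_ge0.
  by move=> i; rewrite subr_ge0.
rewrite (_ : (fun i => _) = (fun i => v i + -1 * u i)); last first.
  by apply/funext => i; rewrite mulN1r.
by apply: abs_summableD => //; exact: abs_summableZ.
Qed.

Lemma ler_norm_signed_sum u M : (forall i, `|u i| <= M i) -> abs_summable M ->
  `|signed_sum u| <= signed_sum M.
Proof.
move=> uM sM; have su := abs_summable_le uM sM.
rewrite ler_norml; apply/andP; split; last first.
  by apply: ler_signed_sum => // i; exact: le_trans (ler_norm _) (uM i).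
rewrite -mulN1r -signed_sumZ//; apply: ler_signed_sum => //;
  first exact: abs_summableZ.
by move=> i; rewrite mulN1r; have := uM i; rewrite ler_norml => /andP[].
Qed.

Lemma signed_sum_single (i0 : T) u : (forall i, i != i0 -> u i = 0) ->
  signed_sum u = u i0.
Proof.
move=> u0; rewrite /signed_sum.
have E (f : T -> \bar R) : (forall i, 0 <= f i)%E ->
  (forall i, i != i0 -> f i = 0%E) ->
    esum setT f = f i0.
  move=> f0 fz; rewrite (esumID [set i0])//.
  rewrite [X in (_ + X)%E]esum1 ?adde0 ?setTI; last first.
    by move=> i /= /eqP/fz.
  by rewrite esum_set1.
rewrite !E//.
- by rewrite -[X in fine X]/(((EFin \o u)^\+ \- (EFin \o u)^\-) i0)%E
  -funeposneg.
- by move=> i /u0 ui; rewrite funenegE /= ui oppr0 maxxx.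
- by move=> i /u0 ui; rewrite funeposE /= ui maxxx.
Qed.

End signed_sums.

Lemma esum_reindex_inj (R : realType) (T T' : choiceType) (e : T -> T')
    (f : T' -> \bar R) : injective e ->
  (forall j, (forall i, j <> e i) -> f j = 0%E) ->
  (\esum_(j in [set: T']) f j = \esum_(i in [set: T]) f (e i))%E.
Proof.
move=> einj f0; rewrite -(esum_image setT e); last by move=> x y _ _;
  exact: einj.
rewrite [RHS]esum_mkcond; apply: eq_esum => j _; case: ifPn => //.
by rewrite notin_setE => nj; apply: f0 => i ji; apply: nj; exists i.
Qed.

Lemma signed_sum_reindex (R : realType) (T T' : choiceType) (e : T -> T')
  (u : T' -> R) :
  injective e -> (forall j, (forall i, j <> e i) -> u j = 0) ->
  signed_sum u = signed_sum (u \o e).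
Proof.
move=> einj u0; rewrite /signed_sum; congr (fine (_ - _)%E).
- rewrite (esum_reindex_inj einj); first by apply: eq_esum => i _;
  rewrite !funeposE.
  by move=> j /u0 uj; rewrite funeposE /= uj maxxx.
- rewrite (esum_reindex_inj einj); first by apply: eq_esum => i _;
  rewrite !funenegE.
  by move=> j /u0 uj; rewrite funenegE /= uj oppr0 maxxx.
Qed.

Lemma abs_summable_inj (R : realType) (T T' : choiceType) (e : T -> T')
  (u : T' -> R) :
  injective e -> abs_summable u -> abs_summable (u \o e).
Proof.
move=> einj; apply: le_lt_trans.
rewrite /= -(esum_image setT e (fun j => `|(u j)%:E|%E));
  last by move=> x y _ _; exact: einj.
by rewrite esum_mkcond; apply: le_esum => j _; case: ifPn.
Qed.

(** * Power series in several variables *)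

Section monomials.
Context {R : realType}.

(** Here and below the full power [r ^+ n] is kept and displacements are
    measured relative to [r]: the bounds then multiply well over coordinates,
    and no exponent [n.-1] appears in them. *)
Lemma exprn_lip (r d x y : R) n : 0 < r -> `|x| <= r -> `|y| <= r ->
  `|x - y| <= d -> `|x ^+ n - y ^+ n| <= n%:R * r ^+ n * (d / r).
Proof.
move=> r0 xr yr xyd; elim: n => [|n IH];
  first by rewrite !expr0 subrr normr0 !mul0r.
rewrite (_ : x ^+ n.+1 - y ^+ n.+1 = x * (x ^+ n - y ^+ n) + (x - y) * y ^+ n);
  last first.
  by rewrite !exprS; ring.
rewrite (le_trans (ler_normD _ _))// !normrM normrX.
have -> : n.+1%:R * r ^+ n.+1 * (d / r) =
    r * (n%:R * r ^+ n * (d / r)) + d * r ^+ n.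
  by rewrite -natr1 exprS; field; rewrite gt_eqF.
by rewrite lerD// ler_pM// lerXn2r// nnegrE// ltW.
Qed.

Lemma exprn_taylor2 (r x y : R) n : 0 < r -> `|x| <= r -> `|y| <= r ->
  `|x ^+ n - y ^+ n - (x - y) * (n%:R * y ^+ n.-1)| <=
  n%:R ^+ 2 * r ^+ n * ((x - y) / r) ^+ 2.
Proof.
move=> r0 xr yr; elim: n => [|n IH].
  by rewrite !expr0 !mul0r mulr0 subrr subr0 normr0 expr0n/= !mul0r.
set E := (X in `|X|) in IH.
(* The remainder [E_n] satisfies
   [E_(n+1) = x * E_n + n * y ^+ (n - 1) * (x - y) ^+ 2]. *)
have -> : x ^+ n.+1 - y ^+ n.+1 - (x - y) * (n.+1%:R * y ^+ n.+1.-1) =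
   x * E + n%:R * y ^+ n.-1 * (x - y) ^+ 2.
  rewrite /E; case: n {IH E} => [|n] /=; first by rewrite !expr0 !expr1 !mulr0n;
    ring.
  by rewrite !exprS; ring.
rewrite (le_trans (ler_normD _ _))// normrM.
rewrite (_ : _ * ((x - y) / r) ^+ 2 =
  r * (n%:R ^+ 2 * r ^+ n * ((x - y) / r) ^+ 2) +
  ((n.+1%:R ^+ 2 - n%:R ^+ 2) * r ^+ n.+1 * ((x - y) / r) ^+ 2)); last first.
  by rewrite (exprS r); move: ((x - y) / r) (r ^+ n) => t rn; ring.
apply: lerD; first exact: ler_pM.
rewrite normrM (ger0_norm (sqr_ge0 _)) normrM normr_nat normrX.
rewrite (_ : _ * ((x - y) / r) ^+ 2 =
  (2 * n%:R + 1) * (r ^+ n.+1 / r ^+ 2) * (x - y) ^+ 2); last first.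
  by rewrite expr_div_n -natr1; ring.
apply: ler_wpM2r; first exact: sqr_ge0.
case: n {IH E} => [|n].
  by rewrite !mul0r mulr_ge0 ?divr_ge0 ?exprn_ge0 ?addr_ge0 ?mulr_ge0 // ltW.
rewrite (_ : r ^+ n.+2 / _ = r ^+ n); last first.
  by rewrite -addn2 exprD mulfK// expf_neq0// gt_eqF.
by apply: ler_pM => //=; rewrite ?exprn_ge0 ?lerXn2r ?nnegrE// ?(ltW r0)//;
  have := ler0n R n.+1; lra.
Qed.

(** Relative Lipschitz constants add up in a product, by telescoping. *)
Lemma prod_lip (I : Type) (s : seq I) (P : pred I) (a b A k : I -> R) (t : R) :
  0 <= t ->
  (forall i, `|a i| <= A i) -> (forall i, `|b i| <= A i) ->
    (forall i, 0 <= k i) ->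
  (forall i, `|a i - b i| <= k i * A i * t) ->
  `|\prod_(i <- s | P i) a i - \prod_(i <- s | P i) b i| <=
  (\sum_(i <- s | P i) k i) * (\prod_(i <- s | P i) A i) * t.
Proof.
move=> t0 aA bA k0 abt; have A0 i : 0 <= A i := le_trans (normr_ge0 _) (aA i).
elim: s => [|i s IH]; first by rewrite !big_nil subrr normr0 !mul0r.
rewrite !big_cons; case: ifP => // _.
set pa := \prod_(j <- s | P j) a j; set pb := \prod_(j <- s | P j) b j.
rewrite (_ : a i * pa - b i * pb = a i * (pa - pb) + (a i - b i) * pb);
  last by ring.
rewrite (le_trans (ler_normD _ _))// !normrM.
set S := \sum_(j <- s | P j) k j; set PA := \prod_(j <- s | P j) A j.
rewrite (_ : (k i + S) * _ * t = A i * (S * PA * t) + (k i * A i * t) * PA);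
  last by ring.
apply: lerD; apply: ler_pM => //.
by rewrite normr_prod; apply: ler_prod => j _; rewrite normr_ge0 bA.
Qed.

Context {p : nat}.
Implicit Types (al : {ffun 'I_p -> nat}) (x y : 'I_p -> R).

Definition monomial al x : R := \prod_(i < p) x i ^+ al i.

Definition deg al : nat := (\sum_(i < p) al i)%N.

Lemma monomial_cst al (r : R) : monomial al (fun=> r) = r ^+ deg al.
Proof. by rewrite /monomial /deg -expr_sum. Qed.

Lemma norm_monomial al x (r : R) : (forall i, `|x i| <= r) ->
  `|monomial al x| <= r ^+ deg al.
Proof.
move=> xr; rewrite -monomial_cst normr_prod; apply: ler_prod => i _.
by rewrite normr_ge0 normrX lerXn2r ?nnegrE// (le_trans _ (xr i)).
Qed.

Lemma monomial_lip al x y (r d : R) : 0 < r ->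
  (forall i, `|x i| <= r) -> (forall i, `|y i| <= r) ->
  (forall i, `|x i - y i| <= d) -> 0 <= d ->
  `|monomial al x - monomial al y| <= (deg al)%:R * r ^+ deg al * (d / r).
Proof.
move=> r0 xr yr xyd d0; rewrite -[r ^+ deg al]monomial_cst /monomial /deg
  natr_sum.
apply: prod_lip => //; first by rewrite divr_ge0// ltW.
- by move=> i; rewrite normrX lerXn2r ?nnegrE// (le_trans _ (xr i)).
- by move=> i; rewrite normrX lerXn2r ?nnegrE// (le_trans _ (yr i)).
- by move=> i; exact: exprn_lip.
Qed.

(** The truncated exponent is harmless: the factor [(al i)%:R] vanishes when
    [al i = 0]. *)
Definition monomial_deriv i al x : R :=
  (al i)%:R * x i ^+ (al i).-1 * \prod_(j < p | j != i) x j ^+ al j.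

Lemma monomial_taylor2 i al x y (r : R) : 0 < r ->
  (forall j, `|x j| <= r) -> (forall j, `|y j| <= r) ->
  (forall j, j != i -> x j = y j) ->
  `|monomial al x - monomial al y - (x i - y i) * monomial_deriv i al y| <=
  (deg al)%:R ^+ 2 * r ^+ deg al * ((x i - y i) / r) ^+ 2.
Proof.
move=> r0 xr yr xy; rewrite -[r ^+ deg al]monomial_cst /monomial
  /monomial_deriv.
rewrite (bigD1 i)//= [X in _ - X - _](bigD1 i)//=
  [X in _ <= _ * X * _](bigD1 i)//=.
rewrite (eq_bigr (fun j => y j ^+ al j)); last by move=> j ji; rewrite xy.
set Q := \prod_(j < p | _) _.
rewrite (_ : _ - _ - _ = (x i ^+ al i - y i ^+ al i -
    (x i - y i) * ((al i)%:R * y i ^+ (al i).-1)) * Q); last by ring.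
rewrite normrM; set PR := \prod_(j < p | _) _.
rewrite (_ : _ * ((x i - y i) / r) ^+ 2 =
   ((deg al)%:R ^+ 2 * r ^+ al i * ((x i - y i) / r) ^+ 2) * PR); last by ring.
apply: ler_pM => //; last first.
  rewrite /Q normr_prod; apply: ler_prod => j _.
  by rewrite normr_ge0 normrX lerXn2r ?nnegrE// (le_trans _ (yr j)).
apply: le_trans (exprn_taylor2 _ r0 (xr i) (yr i)) _.
apply: ler_wpM2r; first exact: sqr_ge0.
apply: ler_wpM2r; first by rewrite exprn_ge0// ltW.
by rewrite lerXn2r ?nnegrE// ler_nat /deg (bigD1 i)//= leq_addr.
Qed.

Definition incr i al : {ffun 'I_p -> nat} := [ffun j => (al j + (j == i))%N].

Lemma incr_inj i : injective (incr i).
Proof.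
move=> al be /ffunP eab; apply/ffunP => j.
by have := eab j; rewrite !ffunE => /addIn.
Qed.

Lemma deg_incr i al : deg (incr i al) = (deg al).+1.
Proof.
rewrite /deg; under eq_bigr do rewrite ffunE.
by rewrite big_split/= -big_mkcond/= big_pred1_eq addn1.
Qed.

Lemma monomial_deriv_incr i al x : monomial_deriv i (incr i al) x =
  (al i).+1%:R * monomial al x.
Proof.
rewrite /monomial_deriv /monomial [in RHS](bigD1 i)//= !ffunE eqxx addn1/=
  mulrA.
by congr (_ * _); apply: eq_bigr => j ji; rewrite ffunE (negbTE ji) addn0.
Qed.

(** With [incr_inj] and [monomial_deriv_incr], this turns the sum of the
    differentiated terms of a power series into a power series, by reindexing
    along [incr i]. *)
Lemma monomial_deriv_notincr i al x : (forall be, al <> incr i be) ->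
  monomial_deriv i al x = 0.
Proof.
move=> nal; rewrite /monomial_deriv; case E : (al i) => [|n];
  first by rewrite !mul0r.
exfalso; apply: (nal [ffun j => (al j - (j == i))%N]); apply/ffunP => j.
by rewrite !ffunE; case: eqVneq => [->|]; rewrite ?subn0 ?addn0// E subn1 addn1.
Qed.

End monomials.

Section power_series.
Context {R : realType} {p : nat}.
Implicit Types (al : {ffun 'I_p -> nat}) (x y : 'I_p -> R)
  (a : {ffun 'I_p -> nat} -> R).

Definition power_series a x : R := signed_sum (fun al => a al * monomial al x).

(** Convergence at the corner [(rho, ..., rho)], which controls the whole
    polydisc of radius [rho]. *)
Definition abs_convergent a (rho : R) := 0 < rho /\
  abs_summable (fun al => a al * rho ^+ deg al).

Definition deriv_coef i a al : R := (al i).+1%:R * a (incr i al).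

(** Dividing the radius by 4 pays for two derivatives, as [n ^ 2 <= 4 ^ n]. *)
Lemma deg_sq_bound (n : nat) (rho c : R) : 0 < rho ->
  `|c| * (n%:R ^+ 2 * (rho / 4) ^+ n) <= `|c * rho ^+ n|.
Proof.
move=> r0; rewrite normrM; apply: ler_wpM2l => //.
rewrite ger0_norm ?exprn_ge0 ?(ltW r0)// expr_div_n mulrCA ler_piMr ?exprn_ge0
  ?(ltW r0)//.
rewrite ltW// ltr_pdivrMr ?exprn_gt0// mul1r -!natrX ltr_nat.
by rewrite -[4%N]/(2 ^ 2)%N -expnM mulnC expnM ltn_sqr ltn_expl.
Qed.

Lemma deg_bound (n : nat) (rho c : R) : 0 < rho ->
  `|c| * (n%:R * (rho / 4) ^+ n) <= `|c * rho ^+ n|.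
Proof.
move=> r0; apply: le_trans (deg_sq_bound n c r0); apply: ler_wpM2l => //.
apply: ler_wpM2r; first by rewrite exprn_ge0// divr_ge0// ltW.
by rewrite -natrX ler_nat; case: n => // n; rewrite expnS leq_pmulr// expn_gt0.
Qed.

Lemma power_series_summable a rho x : abs_convergent a rho ->
  (forall i, `|x i| <= rho) ->
  abs_summable (fun al => a al * monomial al x).
Proof.
move=> [r0 sa] xr; apply: abs_summable_le (abs_summable_norm sa) => al.
rewrite !normrM ler_wpM2l// [leRHS]ger0_norm ?exprn_ge0 ?(ltW r0)//.
exact: norm_monomial.
Qed.

Lemma power_series_at0 a : power_series a (fun=> 0) = a [ffun=> 0%N].
Proof.
rewrite /power_series (signed_sum_single (i0 := [ffun=> 0%N])).
  by rewrite /monomial big1 ?mulr1// => i _; rewrite ffunE expr0.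
move=> al al0; rewrite /monomial.
have [i ali] : exists i, al i != 0%N.
  apply/existsP; apply: contraNT al0; rewrite negb_exists => /forallP al0.
  by apply/eqP/ffunP => i; rewrite ffunE; apply/eqP; rewrite -[_ == _]negbK al0.
by rewrite (bigD1 i)//= expr0n (negbTE ali) mul0r mulr0.
Qed.

Lemma quarter_le (rho : R) : 0 < rho -> rho / 4 <= rho.
Proof. by move=> ?; lra. Qed.

Lemma power_series_lip a rho : abs_convergent a rho -> exists2 L, 0 <= L &
  forall x y (d : R), (forall i, `|x i| <= rho / 4) ->
    (forall i, `|y i| <= rho / 4) ->
  (forall i, `|x i - y i| <= d) -> 0 <= d ->
  `|power_series a x - power_series a y| <= L * d.
Proof.
move=> pa; have [r0 sa] := pa; have sM := abs_summable_norm sa.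
have r40 : 0 < rho / 4 by rewrite divr_gt0.
pose M al : R := `|a al * rho ^+ deg al|.
exists (signed_sum M / (rho / 4)); first by apply: divr_ge0;
  [by apply: signed_sum_ge0 => // al; exact: normr_ge0|exact: ltW].
move=> x y d xr yr xyd d0; rewrite /power_series -signed_sumB; last 2 first.
- by apply: (power_series_summable pa) => i;
  rewrite (le_trans (xr i))// quarter_le.
- by apply: (power_series_summable pa) => i;
  rewrite (le_trans (yr i))// quarter_le.
rewrite mulrAC -mulrA mulrC -signed_sumZ//; apply: ler_norm_signed_sum;
  last exact: abs_summableZ.
move=> al; rewrite -mulrBr normrM.
apply: le_trans (ler_wpM2l (normr_ge0 _) (monomial_lip al r40 xr yr xyd d0)) _.
rewrite [leLHS]mulrA [leLHS]mulrC ler_wpM2l ?divr_ge0 ?(ltW r0)//;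
  exact: deg_bound.
Qed.

Lemma abs_convergent_deriv_coef i a rho : abs_convergent a rho ->
  abs_convergent (deriv_coef i a) (rho / 4).
Proof.
move=> [r0 sa]; split; first by rewrite divr_gt0.
have := abs_summableZ (rho / 4)^-1
  (abs_summable_norm (abs_summable_inj (incr_inj (i:=i)) sa)).
apply: abs_summable_le => al /=.
rewrite ler_pdivlMl ?divr_gt0//.
apply: le_trans (deg_bound (deg (incr i al)) (a (incr i al)) r0).
rewrite /deriv_coef !normrM normr_nat [`|_ ^+ _|]ger0_norm ?exprn_ge0 ?divr_ge0
  ?(ltW r0)// deg_incr exprS.
rewrite [leRHS](_ : _ = rho / 4 *
  ((deg al).+1%:R * `|a (incr i al)| * (rho / 4) ^+ deg al)); last by ring.
apply: ler_wpM2l; first by rewrite divr_ge0// ltW.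
apply: ler_wpM2r; first by rewrite exprn_ge0// divr_ge0// ltW.
by apply: ler_wpM2r => //; rewrite ler_nat ltnS /deg (bigD1 i)//= leq_addr.
Qed.

Lemma power_series_deriv_coef i a x : power_series (deriv_coef i a) x =
  signed_sum (fun al => a al * monomial_deriv i al x).
Proof.
rewrite (signed_sum_reindex (incr_inj (i:=i))); last first.
  by move=> al /monomial_deriv_notincr->; rewrite mulr0.
by congr signed_sum; apply/funext => al /=;
  rewrite monomial_deriv_incr /deriv_coef; ring.
Qed.

(** Differentiability in the direction [i], in the only form that is needed: a
    quadratic remainder, uniform on the polydisc of radius [rho / 4]. *)
Lemma power_series_taylor2 i a rho : abs_convergent a rho -> exists2 K, 0 <= K &
  forall x y, (forall j, `|x j| <= rho / 4) -> (forall j, `|y j| <= rho / 4) ->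
  (forall j, j != i -> x j = y j) ->
  `|power_series a x - power_series a y -
    (x i - y i) * power_series (deriv_coef i a) y| <= K * (x i - y i) ^+ 2.
Proof.
move=> pa; have [r0 sa] := pa; have sM := abs_summable_norm sa.
have r40 : 0 < rho / 4 by rewrite divr_gt0.
pose M al : R := `|a al * rho ^+ deg al|.
exists (signed_sum M / (rho / 4) ^+ 2); first by apply: divr_ge0;
  [by apply: signed_sum_ge0 => // al; exact: normr_ge0|exact/exprn_ge0/ltW].
move=> x y xr yr xy; rewrite power_series_deriv_coef.
have sx : abs_summable (fun al => a al * monomial al x).
  by apply: (power_series_summable pa) => j;
    rewrite (le_trans (xr j))// quarter_le.
have sy : abs_summable (fun al => a al * monomial al y).
  by apply: (power_series_summable pa) => j;
    rewrite (le_trans (yr j))// quarter_le.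
have sd : abs_summable (fun al => a al * monomial_deriv i al y).
  apply: abs_summable_le (abs_summableZ (rho / 4)^-1 sM) => al.
  rewrite ler_pdivlMl//.
  apply: le_trans (deg_bound (deg al) (a al) r0).
  rewrite normrM mulrCA ler_wpM2l// /monomial_deriv.
  case E : (al i) => [|n]; first by rewrite !mul0r normr0 mulr0
    mulr_ge0// exprn_ge0// ltW.
  rewrite -[(_ / _) ^+ deg al]monomial_cst /monomial [in leRHS](bigD1 i)//= E
    exprS.
  rewrite !normrM normr_nat.
  rewrite [leLHS](_ : _ = n.+1%:R *
    (rho / 4 * `|y i ^+ n| * `|\prod_(j < p | j != i) y j ^+ al j|));
    last by ring.
  apply: ler_pM => //; first by rewrite !mulr_ge0// ltW.
    by rewrite ler_nat /deg (bigD1 i)//= E leq_addr.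
  apply: ler_pM => //; first by rewrite mulr_ge0// ltW.
    by rewrite ler_wpM2l ?(ltW r40)// normrX lerXn2r ?nnegrE ?(ltW r40)//.
  rewrite normr_prod; apply: ler_prod => j _.
  by rewrite normr_ge0 normrX lerXn2r ?nnegrE// (le_trans _ (yr j)).
have sxy := abs_summableD sx (abs_summableZ (-1) sy).
have sd' := abs_summableZ (x i - y i) sd.
rewrite /power_series -signed_sumB// -signed_sumZ// -signed_sumB//; last first.
  by under eq_fun do rewrite -mulN1r.
rewrite mulrAC -mulrA mulrC -signed_sumZ//; apply: ler_norm_signed_sum;
  last exact: abs_summableZ.
move=> al; rewrite mulrCA -!mulrBr normrM.
apply: le_trans (ler_wpM2l (normr_ge0 _) (monomial_taylor2 al r40 xr yr xy)) _.
rewrite [leLHS]mulrA [leLHS]mulrC -expr_div_n ler_wpM2l ?sqr_ge0//;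
  exact: deg_sq_bound.
Qed.
End power_series.

(** * Sets of zero content *)

Section null_covers.
Context {R : realType} {p : nat}.
Implicit Types (x z : 'rV[R]_p) (A B : set 'rV[R]_p) (s l e : R).

Definition cube z l : set 'rV[R]_p := [set x | forall j, `|x 0 j - z 0 j| <= l].

(** For [s > 0] the bound on the sum already forces every cube to be small, so
    that no mesh of the covers has to be prescribed as in the definition of
    Hausdorff measure. *)
Definition content_null s A := forall e, 0 < e ->
  exists (z : nat -> 'rV[R]_p) (l : nat -> R),
  [/\ forall k, 0 <= l k, A `<=` \bigcup_k cube (z k) (l k)
    & (\esum_(k in [set: nat]) (l k `^ s)%:E <= e%:E)%E].

Lemma content_null_sub s A B : A `<=` B -> content_null s B -> content_null s A.
Proof.
move=> AB nB e e0; have [z [l [l0 Bc le]]] := nB _ e0.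
by exists z, l; split => //; exact: subset_trans Bc.
Qed.

(** Cubes of side zero cost nothing when [s > 0]; they are used for the
    integers that encode no element of [I]. *)
Lemma content_null_countable_cover s A : 0 < s ->
  (forall e, 0 < e -> exists (I : countType) (z : I -> 'rV[R]_p) (l : I -> R),
  [/\ forall i, 0 <= l i, A `<=` \bigcup_(i in setT) cube (z i) (l i)
    & (\esum_(i in [set: I]) (l i `^ s)%:E <= e%:E)%E]) -> content_null s A.
Proof.
move=> s0 H e e0; have [I [z [l [l0 Ac le]]]] := H _ e0.
exists (fun k => if @pickle_inv I k is Some i then z i else 0).
exists (fun k => if @pickle_inv I k is Some i then l i else 0); split.
- by move=> k; case: pickle_inv.
- by move=> x /Ac[i _ xi]; exists (pickle i) => //=; rewrite pickleK_inv.
rewrite (@esum_reindex_inj _ _ _ (@pickle I)).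
- by under eq_esum => i _ do rewrite pickleK_inv.
- exact: pcan_inj (@pickleK I).
move=> k nk; case E : pickle_inv => [i|]; last by rewrite powR0// gt_eqF.
by exfalso; apply: (nk i); have := @pickle_invK I k; rewrite /oapp E.
Qed.

Lemma content_null0 s : 0 < s -> content_null s set0.
Proof.
move=> s0 e e0; exists (fun=> 0), (fun=> 0); split => //.
by rewrite esum1 ?lee_fin ?ltW// => k _; rewrite powR0// gt_eqF.
Qed.

Lemma content_null_bigcup s (I : countType) (A : I -> set 'rV[R]_p) : 0 < s ->
  (forall i, content_null s (A i)) -> content_null s (\bigcup_(i in setT) A i).
Proof.
move=> s0 nA; apply: content_null_countable_cover => // e e0.
pose e_ (i : I) : R := e / (2 ^ (pickle i).+1)%:R.
have e_0 i : 0 < e_ i by rewrite divr_gt0// ltr0n expn_gt0.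
have /choice[z /choice[l zl]] : forall i, exists z : nat -> 'rV[R]_p,
  exists l : nat -> R,
   [/\ forall k, 0 <= l k, A i `<=` \bigcup_k cube (z k) (l k)
    & (\esum_(k in [set: nat]) (l k `^ s)%:E <= (e_ i)%:E)%E].
  by move=> i; exact: nA.
exists (I * nat)%type, (fun ik => z ik.1 ik.2), (fun ik => l ik.1 ik.2); split.
- by move=> [i k]; have [l0 _ _] := zl i; exact: l0.
- move=> x [i _ Aix]; have [_ Ac _] := zl i.
  by have [k _ xk] := Ac _ Aix; exists (i, k).
have -> : [set: I * nat] = [set: I] `*`` (fun=> [set: nat]) by apply/seteqP;
  split.
rewrite -(@esum_esum _ _ _ setT (fun=> setT) (fun i k => (l i k `^ s)%:E));
  last first.
  by move=> i k _ _; rewrite lee_fin powR_ge0.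
apply: (@le_trans _ _ (\esum_(i in [set: I]) (e_ i)%:E)%E).
  by apply: le_esum => i _; have [] := zl i.
rewrite -(esum_image setT (@pickle I) (fun k => (e / (2 ^ k.+1)%:R)%:E));
  last first.
  by move=> i j _ _; exact: (pcan_inj (@pickleK I)).
apply: (@le_trans _ _ (\esum_(k in [set: nat]) (e / (2 ^ k.+1)%:R)%:E)%E).
  rewrite esum_mkcond; apply: le_esum => k _; case: ifPn => // _.
  by rewrite lee_fin divr_ge0// ltW.
rewrite -nneseries_esumT; last by move=> k; rewrite lee_fin divr_ge0// ltW.
by apply: epsilon_trick0; rewrite ltW.
Qed.

Lemma content_nullU s A B : 0 < s -> content_null s A -> content_null s B ->
  content_null s (A `|` B).
Proof.
move=> s0 nA nB;
  apply: (@content_null_sub _ _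
  (\bigcup_(b in [set: bool]) (if b then A else B))).
  by move=> x [Ax|Bx]; [exists true|exists false].
by apply: content_null_bigcup => // -[].
Qed.

(** Lindelof: the cubes with rational centre and radius [1 / (n + 1)] are
    countably many, and those in which [A] is null cover [A]. *)
Lemma content_null_local s A : 0 < s ->
  (forall x, A x -> exists2 r, 0 < r & content_null s (A `&` cube x r)) ->
    content_null s A.
Proof.
move=> s0 loc.
pose q2r (q : {ffun 'I_p -> rat}) : 'rV[R]_p := \row_j ratr (q j).
pose B (qn : {ffun 'I_p -> rat} * nat) := A `&` cube (q2r qn.1) (qn.2.+1%:R^-1).
pose C qn := [set x | B qn x /\ content_null s (B qn)].
apply: (@content_null_sub _ _ (\bigcup_(qn in setT) C qn)); last first.
  apply: content_null_bigcup => // qn;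
    have [nB|nB] := pselect (content_null s (B qn)).
    by apply: content_null_sub nB => x [].
  by apply: content_null_sub (content_null0 s0) => x [].
move=> x Ax; have [r r0 nr] := loc _ Ax.
have [n nr2] : exists n, n.+1%:R^-1 <= r / 2.
  exists (Num.truncn (r / 2)^-1); rewrite invf_ple ?posrE ?divr_gt0//.
  by rewrite ltW// truncnS_gt.
have n0 : (0 : R) < n.+1%:R^-1 by rewrite invr_gt0.
have /choice[q xq] : forall j, exists q : rat, `|x 0 j - ratr q| <= n.+1%:R^-1.
  move=> j; have [q] := @rat_in_itvoo R (x 0 j) (x 0 j + n.+1%:R^-1)
    ltac:(by rewrite ltrDl).
  by rewrite in_itv/= => /andP[q1 q2]; exists q; rewrite ler_norml;
    move: n0 q1 q2; set dd := _^-1 => n0 q1 q2; apply/andP; split; lra.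
have Bx : B ([ffun j => q j], n) x.
  by split => //= j; rewrite mxE ffunE.
exists ([ffun j => q j], n) => //; split => //.
apply: content_null_sub nr => y [Ay yq]; split => // j.
have := yq j; have := xq j; rewrite mxE ffunE !ler_norml /=.
move: nr2; set dd := _^-1 => ? /andP[? ?] /andP[? ?].
by apply/andP; split; lra.
Qed.

End null_covers.

Lemma esum_finType (R : realType) (I : finType) (f : I -> \bar R) :
  (forall i, 0 <= f i)%E -> (\esum_(i in [set: I]) f i = \sum_(i : I) f i)%E.
Proof.
move=> f0; have IE : [set: I] = [set` index_enum I].
  by apply/seteqP; split => // i _ /=; rewrite mem_index_enum.
rewrite IE esum_fset; [exact/esym/fsbig_seq/index_enum_uniq|exact: finite_seq|].
by move=> i _; exact: f0.
Qed.

Section sheets.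
Context {R : realType}.

Lemma column_index (M : nat) (t : R) : (0 < M)%N -> 0 <= t <= M%:R ->
  exists k : 'I_M, k%:R <= t <= k.+1%:R.
Proof.
move=> M0 /andP[t0 tM]; have [tltM|] := ltP t M%:R; last first.
  move=> Mt; have tE : t = M%:R by apply/eqP; rewrite eq_le tM.
  have ltM : (M.-1 < M)%N by rewrite prednK.
  by exists (Ordinal ltM); rewrite /= prednK// tE lexx ler_nat leq_pred.
have /andP[k1 k2] := truncn_itv t0.
have kM : (Num.truncn t < M)%N by rewrite -(ltr_nat R) (le_lt_trans k1).
by exists (Ordinal kM); rewrite k1 ltW.
Qed.

Lemma powR_archi (t C : R) : 0 < t -> 0 <= C -> exists N : nat,
  C <= N.+1%:R `^ t.
Proof.
move=> t0 C0; exists (Num.truncn (C `^ t^-1)).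
rewrite [leLHS](_ : C = (C `^ t^-1) `^ t);
  last by rewrite -powRrM mulVf ?gt_eqF// powRr1.
apply: ge0_ler_powR; rewrite ?nnegrE ?powR_ge0 ?(ltW t0)//.
by rewrite ltW// truncnS_gt.
Qed.

Context {q : nat}.
Implicit Types (x y : 'rV[R]_q.+1) (A : set 'rV[R]_q.+1).

(** [A] is contained in the graph of a Lipschitz function of the [q] coordinates
    other than [i].  With [N + 1] subdivisions of each of these coordinates, two
    points of [A] in the same column differ by at most [K * w] in the direction
    [i], where [w] is the width of the columns.  Hence [(N + 1) ^ q] cubes of
    size [(K + 1) * w = C / (N + 1)] suffice, and the cost
    [C ^ s * (N + 1) ^ (q - s)] tends to zero. *)
Lemma content_null_sheet A (i : 'I_q.+1) x0 (eta K s : R) :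
  0 < eta -> 0 <= K -> q%:R < s -> A `<=` cube x0 eta ->
  (forall x y d, A x -> A y -> 0 <= d ->
     (forall j, j != i -> `|x 0 j - y 0 j| <= d) ->
     `|x 0 i - y 0 i| <= K * d) ->
  content_null s A.
Proof.
move=> eta0 K0 qs Acube sheet.
have s0 : 0 < s by rewrite (le_lt_trans _ qs).
apply: content_null_countable_cover => // e e0.
pose C := (K + 1) * (2 * eta).
have C0 : 0 <= C by rewrite /C; apply: mulr_ge0; lra.
have [N CN] : exists N : nat, C `^ s / e <= N.+1%:R `^ (s - q%:R).
  by apply: powR_archi; rewrite ?subr_gt0// divr_ge0 ?powR_ge0// ltW.
have N0 : 0 < N.+1%:R :> R by [].
pose w : R := 2 * eta / N.+1%:R.
have w0 : 0 < w by rewrite /w divr_gt0// mulr_gt0.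
pose col (c : {ffun 'I_q -> 'I_N.+1}) := [set x | A x /\
  forall j, x0 0 (lift i j) - eta + (c j)%:R * w <= x 0 (lift i j)
            <= x0 0 (lift i j) - eta + (c j).+1%:R * w].
(* The cube attached to a column is centred at some point of [A] in it, if
   there is one. *)
pose z c : 'rV[R]_q.+1 := xget 0 (col c).
exists {ffun 'I_q -> 'I_N.+1}, z, (fun=> (K + 1) * w); split.
- by move=> _; apply: mulr_ge0; [lra|exact: ltW].
- move=> x Ax.
  have /choice[c xc] : forall j, exists k : 'I_N.+1,
      k%:R <= (x 0 (lift i j) - (x0 0 (lift i j) - eta)) / w <= k.+1%:R.
    move=> j; apply: column_index => //.
    have := Acube x Ax (lift i j); rewrite ler_norml => /andP[x1 x2].
    apply/andP; split; first by apply: divr_ge0; [lra|exact: ltW].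
    by rewrite ler_pdivrMr// /w mulrC divfK ?gt_eqF//; lra.
  pose cc : {ffun 'I_q -> 'I_N.+1} := [ffun j => c j].
  have colx : col cc x.
    split => // j; rewrite ffunE; have := xc j.
    by rewrite ler_pdivlMr// ler_pdivrMr// => /andP[? ?]; apply/andP; split;
      lra.
  exists cc => //.
  have [Az zc] : col cc (z cc) by apply: xgetPex; exists x.
  have [_ xcc] := colx.
  have lj j : j != i -> `|x 0 j - z cc 0 j| <= w.
    rewrite eq_sym => /unlift_some[j' -> _].
    have := zc j'; have := xcc j'; rewrite !ffunE -natr1.
    move=> /andP[? ?] /andP[? ?].
    by rewrite ler_norml; apply/andP; split; lra.
  move=> j; have [->|ji] := eqVneq j i.
    apply: le_trans (sheet _ _ w Ax Az (ltW w0) lj) _.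
    by apply: ler_wpM2r; [exact: ltW|lra].
  apply: le_trans (lj _ ji) _; rewrite ler_peMl ?(ltW w0)//; lra.
rewrite esum_finType; last by move=> c; rewrite lee_fin powR_ge0.
rewrite sumEFin lee_fin sumr_const card_ffun !card_ord.
have -> : (K + 1) * w = C / N.+1%:R by rewrite /C /w; ring.
rewrite powRM ?invr_ge0// -[N.+1%:R^-1]powR_inv1// -powRrM.
rewrite -[leLHS]mulr_natr natrX -powR_mulrn// -mulrA -powRD;
  last by rewrite pnatr_eq0 implybT.
rewrite mulN1r addrC -[q%:R - s]opprB powRN.
by rewrite ler_pdivrMr ?powR_gt0// mulrC -ler_pdivrMr.
Qed.

End sheets.

(** * Hausdorff dimension and Lebesgue measure of sets of zero content *)

Section dimension.
Context {R : realType} {p : nat}.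
Implicit Types (A : set 'rV[R]_p) (z : 'rV[R]_p) (s l e : R).

Lemma diam_cube z l : 0 <= l -> (diam (cube z l) <= (p%:R * (2 * l))%:E)%E.
Proof.
move=> l0; apply: ge_ereal_sup => _ [x xz [y yz <-]];
  rewrite lee_fin /euclid_dist.
have M0 : 0 <= p%:R * (2 * l) by rewrite !mulr_ge0.
rewrite -(ler_pXn2r (n := 2))// ?nnegrE ?sqrtr_ge0// sqr_sqrtr; last first.
  by apply: sumr_ge0 => j _; exact: sqr_ge0.
apply: (@le_trans _ _ (\sum_(i < p) (2 * l) ^+ 2)).
  apply: ler_sum => j _; rewrite -real_normK ?num_real// lerXn2r ?nnegrE
    ?mulr_ge0//.
  have := xz j; have := yz j; rewrite !ler_norml => /andP[? ?] /andP[? ?].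
  by apply/andP; split; lra.
rewrite sumr_const card_ord -[leLHS]mulr_natl [leRHS]exprMn; apply: ler_wpM2r;
  first exact: sqr_ge0.
by rewrite -natrX ler_nat; case: p => // n; rewrite leq_pmulr.
Qed.

Lemma diam_ge0 A : A !=set0 -> (0 <= diam A)%E.
Proof.
move=> [x Ax]; apply: ereal_sup_ubound; exists x => //; exists x => //.
by rewrite /euclid_dist big1 ?sqrtr0// => j _; rewrite subrr expr0n.
Qed.

Lemma diam_pow_ge0 s A : (0 <= diam_pow s A)%E.
Proof. by rewrite /diam_pow; case: ifP => // _; exact: poweR_ge0. Qed.

(** A cube of half-side [l] has Euclidean diameter at most [P * l], which
    costs a constant factor [P `^ s]; and each term of a sum is bounded by the
    sum, so that cheap covers have small mesh. *)
Lemma content_null_hausdorff s A : 0 < s -> content_null s A ->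
  hausdorff_measure s A = 0%E.
Proof.
move=> s0 nA; apply/eqP; rewrite eq_le; apply/andP; split; last first.
  apply: (@le_trans _ _ (hausdorff_premeasure s 1 A)); last first.
    apply: ereal_sup_ubound; exists 1 => //; exact: ltr01.
  apply: le_ereal_inf_tmp => _ [V _ <-].
  by apply: nneseries_ge0 => k _ _; exact: diam_pow_ge0.
apply: ge_ereal_sup => _ [delta /= delta0 <-].
pose P : R := p.+1%:R * 2.
have P0 : 0 < P by rewrite mulr_gt0.
have dP z l : 0 <= l -> (diam (cube z l) <= (P * l)%:E)%E.
  move=> l0; apply: le_trans (diam_cube z l0) _; rewrite lee_fin /P -mulrA.
  by rewrite ler_wpM2r ?mulr_ge0// ler_nat.
rewrite -[leRHS]adde0; apply/lee_addgt0Pr => e e0; rewrite adde0 add0e.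
pose e' := Num.min (e / P `^ s) ((delta / P) `^ s).
have e'0 : 0 < e' by rewrite lt_min divr_gt0 ?powR_gt0// divr_gt0.
have [z [l [l0 Ac le]]] := nA _ e'0.
apply: (@le_trans _ _ (\sum_(k <oo) diam_pow s (cube (z k) (l k)))%E).
  apply: ereal_inf_lbound; exists (fun k => cube (z k) (l k)) => //;
    split => // k.
  apply: le_trans (dP _ _ (l0 k)) _; rewrite lee_fin mulrC -ler_pdivlMr//.
  have lke : l k `^ s <= (delta / P) `^ s.
    rewrite -lee_fin; apply: (@le_trans _ _ e'%:E);
      last by rewrite lee_fin ge_min lexx orbT.
    apply: le_trans le; rewrite -(@esum_set1 _ _ k (fun k => (l k `^ s)%:E));
      last first.
      by rewrite lee_fin powR_ge0.
    rewrite [leLHS]esum_mkcond; apply: le_esum => j _.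
    by case: ifPn => // _; rewrite lee_fin powR_ge0.
  rewrite leNgt; apply/negP => lt.
  have : (delta / P) `^ s < l k `^ s.
    by apply: gt0_ltr_powR; rewrite ?nnegrE// ltW// divr_gt0.
  by rewrite ltNge lke.
rewrite nneseries_esumT; last by move=> k; exact: diam_pow_ge0.
apply: (@le_trans _ _ (\esum_(k in [set: nat])
  ((P `^ s)%:E * (l k `^ s)%:E))%E).
  apply: le_esum => k _; rewrite /diam_pow;
    case: ifPn => [_|/asboolPn/eqP/set0P ne].
    by rewrite mule_ge0// lee_fin powR_ge0.
  rewrite -EFinM -powRM ?(ltW P0)// -poweR_EFin.
  apply: gt0_ler_poweR; rewrite ?(ltW s0)// ?in_itv/= ?leey ?andbT ?diam_ge0
    ?lee_fin ?mulr_ge0 ?(ltW P0)//.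
  exact: dP.
rewrite ge0_esumZl ?powR_ge0//; last by move=> k; rewrite lee_fin powR_ge0.
apply: (@le_trans _ _ ((P `^ s)%:E * e'%:E)%E).
  by apply: lee_wpmul2l; rewrite ?lee_fin ?powR_ge0.
by rewrite -EFinM lee_fin mulrC -ler_pdivlMr ?powR_gt0// ge_min lexx.
Qed.

Lemma content_null_hausdorff_dim (t : R) A : 0 <= t ->
  (forall s, t < s -> content_null s A) -> (hausdorff_dim A <= t%:E)%E.
Proof.
move=> t0 nA; apply/lee_addgt0Pr => e e0; rewrite -EFinD.
apply: ereal_inf_lbound; exists (t + e) => //=; split;
  first by rewrite addr_ge0// ltW.
by apply: content_null_hausdorff; [rewrite ltr_wpDl|apply: nA; rewrite ltrDl].
Qed.

Lemma content_null_lebesgue A : content_null p%:R A -> lebesgue_outer A = 0%E.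
Proof.
move=> nA; apply/eqP; rewrite eq_le; apply/andP; split; last first.
  apply: le_ereal_inf_tmp => _ [V [_ V0] <-].
  apply: nneseries_ge0 => k _ _; rewrite lee_fin.
  by apply: prodr_ge0 => i _; rewrite subr_ge0.
rewrite -[leRHS]adde0; apply/lee_addgt0Pr => e e0; rewrite adde0 add0e.
have e20 : 0 < e / 2 ^+ p by rewrite divr_gt0// exprn_gt0.
have [z [l [l0 Ac le]]] := nA _ e20.
pose V k : 'rV[R]_p * 'rV[R]_p :=
  (\row_j (z k 0 j - l k), \row_j (z k 0 j + l k)).
apply: (@le_trans _ _ (\sum_(k <oo)
  (\prod_(i < p) ((V k).2 0 i - (V k).1 0 i))%:E)%E).
  apply: ereal_inf_lbound; exists V => //; split.
    move=> x /Ac[k _ xk]; exists k => // j; rewrite !mxE -ler_distl; exact: xk.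
  by move=> k j; rewrite !mxE; have := l0 k; lra.
rewrite nneseries_esumT; last first.
  move=> k; rewrite lee_fin; apply: prodr_ge0 => i _; rewrite !mxE.
  by have := l0 k; lra.
rewrite (eq_esum (b := fun k => ((2 ^+ p)%:E * (l k `^ p%:R)%:E)%E));
  last first.
  move=> k _; rewrite -EFinM powR_mulrn// -exprMn; congr EFin.
  rewrite (eq_bigr (fun=> 2 * l k)) ?prodr_const ?card_ord// => i _.
  by rewrite !mxE; ring.
rewrite ge0_esumZl ?exprn_ge0//; last by move=> k; rewrite lee_fin powR_ge0.
apply: (@le_trans _ _ ((2 ^+ p)%:E * (e / 2 ^+ p)%:E)%E).
  by apply: lee_wpmul2l; rewrite ?lee_fin ?exprn_ge0.
by rewrite -EFinM mulrC divfK// expf_neq0.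
Qed.

End dimension.

(** * Zero sets of real analytic functions *)

Section zero_set.
Context {R : realType} {q : nat}.
Implicit Types (x y c : 'rV[R]_q.+1) (a : {ffun 'I_q.+1 -> nat} -> R).

Definition coords c x : 'I_q.+1 -> R := fun j => x 0 j - c 0 j.

Lemma decr_multi_index (al : {ffun 'I_q.+1 -> nat}) n : deg al = n.+1 ->
  exists i be, al = incr i be /\ deg be = n.
Proof.
move=> dal.
have [i ali] : exists i, al i != 0%N.
  apply/existsP; apply: contraPT dal; rewrite negb_exists => /forallP al0.
  by rewrite /deg big1// => i _; apply/eqP; rewrite -[_ == _]negbK al0.
pose be : {ffun 'I_q.+1 -> nat} := [ffun j => (al j - (j == i))%N].
have E : al = incr i be.
  apply/ffunP => j; rewrite !ffunE; case: eqVneq => [->|];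
    last by rewrite subn0 addn0.
  by rewrite subn1 addn1 prednK// lt0n.
by exists i, be; split => //; move: dal; rewrite E deg_incr => -[].
Qed.

(** Induction on the degree [n] of a nonzero coefficient.  In degree 0 the
    function has no zero near [c].  In degree [n + 1], a formal derivative [b]
    in some direction [i] has a nonzero coefficient of degree [n]; the zeros
    common to [a] and [b] are dealt with by induction, and the zeros of [a]
    that are not zeros of [b] locally form a sheet.  The second conclusion, that
    there is no open set of zeros near [c], follows in the same way: where [b]
    does not vanish, moving along the direction [i] changes the value. *)
Lemma zero_set_local n : forall a rho c, abs_convergent a rho ->
  (exists2 al, deg al = n & a al != 0) ->
  exists2 r, 0 < r &
    (forall s, q%:R < s ->
       content_null s [set x | cube c r x /\ power_series a (coords c x) = 0])
         /\
    (forall x delta, cube c r x -> 0 < delta ->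
       exists2 y, cube x delta y & power_series a (coords c y) != 0).
Proof.
elim: n => [|n IH] a rho c pa [al dal al0].
  have [rho0 _] := pa; have [L L0 lip] := power_series_lip pa.
  have al00 : al = [ffun=> 0%N].
    apply/ffunP => j; rewrite ffunE; apply/eqP; rewrite -leqn0 -dal.
    by rewrite /deg (bigD1 j)//= leq_addr.
  rewrite al00 in al0; pose m := `|a [ffun=> 0%N]|.
  have m0 : 0 < m by rewrite normr_gt0.
  pose r := Num.min (rho / 4) (m / (2 * (L + 1))).
  have r0 : 0 < r by rewrite lt_min !divr_gt0// mulr_gt0// ltr_wpDl.
  have nz x : cube c r x -> power_series a (coords c x) != 0.
    move=> xr; apply: contraTneq m0 => px; rewrite -leNgt.
    have := lip (coords c x) (fun=> 0) r;
      rewrite px power_series_at0 sub0r normrN -/m.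
    have xr4 i : `|coords c x i| <= rho / 4.
      by apply: le_trans (xr i) _; rewrite ge_min lexx.
    move=> /(_ xr4) H.
    have {}H : m <= L * r.
      apply: H => [i|i|]; first by rewrite normr0 divr_ge0// ltW.
        by rewrite subr0; exact: xr.
      exact: ltW.
    have : r <= m / (2 * (L + 1)) by rewrite ge_min lexx orbT.
    by rewrite ler_pdivlMr ?mulr_gt0 ?ltr_wpDl//; nra.
  exists r => //; split.
    move=> s qs; apply: (@content_null_sub _ _ _ _ set0).
      by move=> x [xr px]; have := nz x xr; rewrite px eqxx.
    by apply: content_null0; exact: le_lt_trans qs.
  by move=> x d xr d0; exists x; [move=> j; rewrite subrr normr0 ltW|exact: nz].
have [i [be [alE dbe]]] := decr_multi_index dal.
have [rho0 _] := pa; have pb := abs_convergent_deriv_coef i pa.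
pose b := deriv_coef i a.
have bbe : b be != 0 by rewrite /b /deriv_coef mulf_neq0 -?alE// pnatr_eq0.
have [rh rh0 [nullh nzh]] := IH b (rho / 4) c pb (ex_intro2 _ _ be dbe bbe).
have [La La0 lipa] := power_series_lip pa;
  have [Lb Lb0 lipb] := power_series_lip pb.
have [K K0 tay] := power_series_taylor2 i pa.
pose r := Num.min rh (rho / 32).
have r0 : 0 < r by rewrite lt_min rh0 divr_gt0.
have rrh : r <= rh by rewrite ge_min lexx.
have rrho : r <= rho / 32 by rewrite ge_min lexx orbT.
exists r => //; split.
  move=> s qs; have s0 : 0 < s by exact: le_lt_trans qs.
  pose S := [set x | [/\ cube c r x, power_series a (coords c x) = 0
    & power_series b (coords c x) != 0]].
  apply: (@content_null_sub _ _ _ _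
    ([set x | cube c rh x /\ power_series b (coords c x) = 0] `|` S)).
    move=> x [xr px]; have [pbx|pbx] := eqVneq (power_series b (coords c x)) 0;
      last by right.
    by left; split => // j; exact: le_trans (xr j) rrh.
  apply: content_nullU => //; first exact: nullh.
  apply: content_null_local => // x [xr px pbx].
  pose m := `|power_series b (coords c x)|.
  have m0 : 0 < m by rewrite normr_gt0.
  (* Within [eta] of [x], the derivative keeps half of its absolute value [m] at
     [x], and for two points the quadratic remainder is at most
     [m / 4] times their distance in the direction [i]. *)
  pose eta := Num.min (m / (4 * (Lb + 1))) (m / (8 * (K + 1))).
  have eta0 : 0 < eta by rewrite lt_min !divr_gt0// mulr_gt0// ltr_wpDl.
  have etaL : eta * (4 * (Lb + 1)) <= m.
    by rewrite -ler_pdivlMr ?ge_min ?lexx// mulr_gt0// ltr_wpDl.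
  have etaK : eta * (8 * (K + 1)) <= m.
    by rewrite -ler_pdivlMr ?ge_min ?lexx ?orbT// mulr_gt0// ltr_wpDl.
  exists eta => //; apply: (@content_null_sheet _ _ _ i x eta (4 * La / m))
    => //.
    by rewrite divr_ge0 ?mulr_ge0// ltW.
  move=> w y d [[wr pw _] wx] [[yr py _] yx] d0 wyd.
  have hy : m / 2 <= `|power_series b (coords c y)|.
    have := lipb (coords c x) (coords c y) eta.
    have bd z : cube c r z -> forall j, `|coords c z j| <= rho / 4 / 4.
      by move=> zr j; apply: le_trans (zr j) _; lra.
    move=> /(_ (bd _ xr) (bd _ yr)) H.
    have {}H : `|power_series b (coords c x) - power_series b (coords c y)| <=
      Lb * eta.
      apply: H; last exact: ltW.
      by move=> j; rewrite /coords opprB addrA subrK distrC; exact: yx.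
    have := lerB_dist (power_series b (coords c x))
      (power_series b (coords c y)); rewrite -/m; nra.
  (* Going from [y] to [w] through [v], the first step is along the direction [i]
     and the second one leaves the [i]-th coordinate unchanged. *)
  pose v j := if j == i then coords c w i else coords c y j.
  have bd z : cube c r z -> forall j, `|coords c z j| <= rho / 4.
    by move=> zr j; apply: le_trans (zr j) _; lra.
  have vbd j : `|v j| <= rho / 4 by rewrite /v; case: ifP => _; exact: bd.
  have vy j : j != i -> v j = coords c y j by rewrite /v => /negbTE->.
  have T := tay v (coords c y) vbd (bd _ yr) vy.
  have vw j : `|v j - coords c w j| <= d.
    have [->|ji] := eqVneq j i; first by rewrite /v eqxx subrr normr0.
    by rewrite vy// /coords opprB addrA subrK distrC; exact: wyd.
  have := lipa v (coords c w) d vbd (bd _ wr) vw d0; rewrite pw subr0 => Ld.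
  have vi : v i - coords c y i = w 0 i - y 0 i by rewrite /v eqxx /coords; ring.
  rewrite py subr0 vi -/b in T; set t := w 0 i - y 0 i in T *.
  have t2 : `|t| <= 2 * eta.
    have := wx i; have := yx i; rewrite /t !ler_norml => /andP[? ?] /andP[? ?].
    by apply/andP; split; lra.
  have {}T : `|t| * `|power_series b (coords c y)| <= La * d + K * `|t| ^+ 2.
    rewrite -normrM real_normK ?num_real//.
    have := ler_normD (power_series a v)
      (- (power_series a v - t * power_series b (coords c y))).
    by rewrite normrN opprB addrC subrK; lra.
  rewrite mulrAC ler_pdivlMr//.
  have : `|t| * (m / 2) <= `|t| * `|power_series b (coords c y)| by rewrite
    ler_wpM2l.
  have : K * `|t| ^+ 2 <= `|t| * (m / 4).
    have Kt : K * `|t| <= K * (2 * eta) by rewrite ler_wpM2l.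
    rewrite (_ : K * _ = `|t| * (K * `|t|)); last by ring.
    by rewrite ler_wpM2l//; lra.
  by lra.
move=> x delta xr delta0.
pose d := Num.min (delta / 2) (rho / 32).
have d0 : 0 < d by rewrite lt_min !divr_gt0.
have d1 : d <= delta / 2 by rewrite ge_min lexx.
have d2 : d <= rho / 32 by rewrite ge_min lexx orbT.
have [|y yx hy] := nzh x d _ d0; first by move=> j; exact: le_trans (xr j) rrh.
have [py|] := eqVneq (power_series a (coords c y)) 0; last first.
  by exists y => // j; apply: le_trans (yx j) _; lra.
pose m := `|power_series b (coords c y)|.
have m0 : 0 < m by rewrite normr_gt0.
pose t := Num.min d (m / (2 * (K + 1))).
have t0 : 0 < t by rewrite lt_min d0 divr_gt0// mulr_gt0// ltr_wpDl.
have td : t <= d by rewrite ge_min lexx.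
have tK : t * (2 * (K + 1)) <= m.
  by rewrite -ler_pdivlMr ?ge_min ?lexx ?orbT// mulr_gt0// ltr_wpDl.
pose w : 'rV[R]_q.+1 := \row_j (if j == i then y 0 i + t else y 0 j).
have wy j : `|w 0 j - y 0 j| <= t.
  rewrite mxE; case: eqVneq => [->|_]; last by rewrite subrr normr0 ltW.
  by rewrite addrAC subrr add0r ger0_norm// ltW.
have ybd j : `|coords c y j| <= rho / 16.
  have := xr j; have := yx j; rewrite /coords !ler_norml => /andP[? ?]
    /andP[? ?].
  by apply/andP; split; lra.
have wbd j : `|coords c w j| <= rho / 4.
  have := ybd j; have := wy j;
    rewrite /coords !ler_norml => /andP[? ?] /andP[? ?].
  by apply/andP; split; lra.
exists w.
  move=> j; have := yx j; have := wy j;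
    rewrite !ler_norml => /andP[? ?] /andP[? ?].
  by apply/andP; split; lra.
apply: contraTneq m0 => pw; rewrite -leNgt.
have := tay (coords c w) (coords c y) wbd.
have ybd4 j : `|coords c y j| <= rho / 4 by apply: le_trans (ybd j) _; lra.
have wyi j : j != i -> coords c w j = coords c y j by rewrite /coords mxE =>
  /negbTE->.
move=> /(_ ybd4 wyi); rewrite pw py subrr sub0r normrN normrM -/b -/m.
have -> : coords c w i - coords c y i = t by rewrite /coords mxE eqxx; ring.
rewrite ger0_norm ?(ltW t0)// expr2 mulrCA ler_pM2l//; nra.
Qed.

End zero_set.

Section analytic.
Context {R : realType} {q : nat}.
Implicit Types (x y c : 'rV[R]_q.+1) (a : {ffun 'I_q.+1 -> nat} -> R).

Lemma near_cube c (P : set 'rV[R]_q.+1) :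
  (\forall x \near c, P x) <-> exists2 r, 0 < r & cube c r `<=` P.
Proof.
split=> [/nbhs_ballP[e /= e0 eP]|[r r0 rP]].
  exists (e / 2); first by rewrite divr_gt0.
  move=> x xe; apply: eP; split => // i j; rewrite [i]ord1 /ball/= distrC.
  by apply: le_lt_trans (xe j) _; rewrite ltr_pdivrMr// ltr_pMr// ltr1n.
apply/nbhs_ballP; exists r => //= x [_ xr]; apply: rP => j.
by have := xr 0 j; rewrite /ball/= distrC => /ltW.
Qed.

(** The expansion holds on a whole cube, in particular at its corner, where
    summability of the terms is absolute convergence on the polydisc. *)
Lemma real_analytic_power_series (D : set 'rV[R]_q.+1) f c : real_analytic D f
  -> D c ->
  exists a r, abs_convergent a r /\ forall x, cube c r x ->
    f x = power_series a (coords c x).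
Proof.
move=> fan /fan[a /near_cube[r r0 rP]]; exists a, r; split; last first.
  by move=> x /rP[_ /(congr1 fine)].
split => //; have [|sm _] := rP (\row_j (c 0 j + r)).
  by move=> j; rewrite mxE addrAC subrr add0r ger0_norm// ltW.
move: sm; rewrite /abs_summable /summable; apply: le_lt_trans.
rewrite le_eqVlt; apply/orP; left; apply/eqP; apply: eq_esum => al _.
rewrite /power_term /= -monomial_cst /monomial; congr (`|(_ * _)%:E|)%E.
by apply: eq_bigr => j _; rewrite mxE addrAC subrr add0r.
Qed.

Lemma power_series0 a (x : _ -> R) : (forall al, a al = 0) ->
  power_series a x = 0.
Proof.
move=> a0; rewrite /power_series (signed_sum_single (i0 := [ffun=> 0%N])) ?a0
  ?mul0r// => al _.
by rewrite a0 mul0r.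
Qed.

(** [W] is the set of points near which [f] vanishes.  At a point of [D] outside
    [W] the expansion of [f] has a nonzero coefficient, so [zero_set_local]
    applies, and its second conclusion keeps [W] away from the point. *)
Lemma real_analytic_zero_set (D : set 'rV[R]_q.+1) f s :
  open D -> connected D -> real_analytic D f ->
  (exists2 x, D x & f x != 0) -> q%:R < s ->
  content_null s [set x | D x /\ f x = 0].
Proof.
move=> oD cD fan [x0 Dx0 fx0] qs.
have s0 : 0 < s by exact: le_lt_trans qs.
pose Z := [set x | f x = 0]; pose W := D `&` interior Z.
have loc c : D c -> ~ W c -> exists2 r, 0 < r &
    content_null s (Z `&` cube c r) /\
    forall x delta, cube c r x -> 0 < delta -> exists2 y,
      cube x delta y & f y != 0.
  move=> Dc nWc; have [a [rho [pa fE]]] := real_analytic_power_series fan Dc.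
  have [rho0 _] := pa.
  have [al al0] : exists al, a al != 0.
    apply: contrapT => na; apply: nWc; split => //.
    apply/near_cube; exists rho => // x xr;
      rewrite /Z /= fE// power_series0// => al.
    by apply/eqP; rewrite -[_ == _]negbK; apply/negP => al0; apply: na;
      exists al.
  have [r r0 [nul nz]] := zero_set_local c pa (ex_intro2 _ _ al erefl al0).
  pose r' := Num.min r (rho / 2).
  have r'r : r' <= r by rewrite ge_min lexx.
  have r'rho : r' <= rho / 2 by rewrite ge_min lexx orbT.
  exists r'; first by rewrite lt_min r0 divr_gt0.
  split.
    apply: content_null_sub (nul _ qs) => x [Zx xr]; split.
      by move=> j; exact: le_trans (xr j) r'r.
    rewrite -fE// => j; apply: le_trans (xr j) _; lra.
  move=> x d xr d0; pose d' := Num.min d (rho / 2).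
  have d'd : d' <= d by rewrite ge_min lexx.
  have d'rho : d' <= rho / 2 by rewrite ge_min lexx orbT.
  have [||y yx py] := nz x d'.
  - by move=> j; exact: le_trans (xr j) r'r.
  - by rewrite lt_min d0 divr_gt0.
  exists y; first by move=> j; exact: le_trans (yx j) d'd.
  rewrite fE// => j; have := xr j; have := yx j.
  rewrite !ler_norml => /andP[? ?] /andP[? ?].
  by apply/andP; split; lra.
have W0 : W = set0.
  apply: contrapT => /eqP/set0P Wn0.
  have WD : W = D.
    apply: cD => //; first by exists (interior Z) => //; exact: open_interior.
    exists (closure W); first exact: closed_closure.
    apply/seteqP; split => [x Wx|x [Dx Wx]].
      by split; [case: Wx|exact: subset_closure].
    apply: contrapT => nWx; have [r r0 [_ nz]] := loc _ Dx nWx.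
    have /Wx[w [[_ Zw] xw]] : nbhs x (cube x r) by apply/near_cube; exists r.
    have /near_cube[e e0 eZ] : \forall x \near w, Z x := Zw.
    by have [y /eZ -> ] := nz _ _ xw e0; rewrite eqxx.
  have : W x0 by rewrite WD.
  by move=> [_ /interior_subset]; rewrite /Z /= => fx00;
    rewrite fx00 eqxx in fx0.
apply: content_null_local => // x [Dx fx].
have [|r r0 [nul _]] := loc x Dx; first by rewrite W0.
by exists r => //; apply: content_null_sub nul => y [[]].
Qed.

End analytic.

(** * The first Hermite coefficient *)

Section gaussian_moments.
Context {R : realType}.
Local Notation mu := (@lebesgue_measure R).

Lemma ge0_integral_gaussian (f : R -> \bar R) :
  measurable_fun setT f -> (forall x, 0 <= f x)%E ->
  (\int[gaussian R]_x f x = \int[mu]_x (f x * (normal_pdf 0 1 x)%:E))%E.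
Proof.
move=> mf f0; have dom := @normal_prob_dominates R 0 1.
rewrite -(@Radon_Nikodym_SigmaFinite.change_of_variables _ _ _ (gaussian R) mu
  dom)//.
have mRN : measurable_fun setT (Radon_Nikodym_SigmaFinite.f (gaussian R) mu).
  exact: measurable_int (Radon_Nikodym_SigmaFinite.f_integrable dom).
have mpdf : measurable_fun setT (EFin \o normal_pdf (0 : R) 1).
  by apply/measurable_EFinP; exact: measurable_normal_pdf.
apply: ae_eq_integral => //; [exact: emeasurable_funM|exact: emeasurable_funM|].
apply: ae_eqe_mul2l; apply: integral_ae_eq => //.
  exact: Radon_Nikodym_SigmaFinite.f_integrable.
by move=> A _ mA; rewrite -Radon_Nikodym_SigmaFinite.f_integral.
Qed.

(** The factor [x ^+ 2] is absorbed by a larger variance, as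
    [3 / 8 * x ^+ 2 <= expR (3 / 8 * x ^+ 2)]. *)
Lemma normal_pdf_moment2_le (x : R) : x ^+ 2 * normal_pdf 0 1 x <=
  8 / 3 * (normal_peak 1 / normal_peak 2) * normal_pdf 0 2 x.
Proof.
rewrite !normal_pdfE ?oner_eq0 ?pnatr_eq0//.
have p2 : normal_peak (2 : R) != 0 by rewrite
  gt_eqF// normal_peak_gt0// pnatr_eq0.
have p1 : 0 < normal_peak (1 : R) by rewrite normal_peak_gt0// oner_eq0.
rewrite [leLHS]mulrCA
  [leRHS](_ : _ = normal_peak 1 * (8 / 3 * normal_fun 0 2 x)); last first.
  by field.
rewrite ler_pM2l// /normal_fun subr0.
have -> : - x ^+ 2 / (2 ^+ 2 *+ 2) =
    - x ^+ 2 / (1 ^+ 2 *+ 2) + (3 / 8) * x ^+ 2.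
  by rewrite !mulr2n; field.
rewrite expRD mulrCA [leLHS]mulrC ler_pM2l ?expR_gt0//.
by have := expR_ge1Dx (3 / 8 * x ^+ 2); lra.
Qed.

Lemma id_Lfun2_gaussian : (@idfun R) \in Lfun (gaussian R) 2%:E.
Proof.
have mid : measurable_fun setT (@idfun R) by exact: measurable_id.
apply/andP; split; rewrite inE//= /finite_norm.
rewrite unlock.
apply: poweR_lty.
under eq_integral => x _ do rewrite /= powR_mulrn// real_normK ?num_real//.
rewrite ge0_integral_gaussian; last 2 first.
- by apply/measurable_EFinP; exact: measurable_funX.
- by move=> x; rewrite lee_fin sqr_ge0.
pose C : R := 8 / 3 * (normal_peak 1 / normal_peak 2).
have C0 : 0 <= C.
  by rewrite /C mulr_ge0// divr_ge0// normal_peak_ge0.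
apply: (@le_lt_trans _ _ (\int[mu]_x (C%:E * (normal_pdf 0 2 x)%:E))%E).
  apply: ge0_le_integral => //.
  - by move=> x _; rewrite -EFinM lee_fin mulr_ge0 ?sqr_ge0 ?normal_pdf_ge0.
  - apply/measurable_EFinP; apply: measurable_funM;
    first exact: measurable_funX.
    exact: measurable_normal_pdf.
  - apply/measurable_EFinP; apply: measurable_funM => //.
    exact: measurable_normal_pdf.
  - by move=> x _; rewrite -!EFinM lee_fin; exact: normal_pdf_moment2_le.
rewrite ge0_integralZl//; last 2 first.
- by apply/measurable_EFinP; exact: measurable_normal_pdf.
- by move=> x _; rewrite lee_fin normal_pdf_ge0.
- by rewrite integral_normal_pdf mule1 ltry.
Qed.

Lemma hermite_rank_ge2 (f : R -> R) :
  (2%:E <= hermite_rank f)%E <->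
  (\int[gaussian R]_x (f x * hermite 1 x)%:E = 0)%E.
Proof.
split=> [h2|f0].
  apply: contrapT => nf0; move: h2; apply/negP; rewrite -ltNge.
  apply: (@le_lt_trans _ _ 1%:E); last by rewrite lte_fin ltr1n.
  by apply: ereal_inf_lbound; exists 1%N.
apply: le_ereal_inf_tmp => _ [m [m1 fm] <-]; rewrite lee_fin ler_nat.
by case: m m1 fm => [|[|m]].
Qed.

Lemma integral_std_normal d (T : measurableType d) (P : probability T R)
    (Z : {RV P >-> R})
    (Z_std_normal : forall A : set R, measurable A ->
       distribution P Z A = gaussian R A) (f : R -> R) :
  (gaussian R).-integrable setT (EFin \o f) ->
  P.-integrable setT (EFin \o (f \o Z)) /\
  (\int[P]_w (f (Z w))%:E = \int[gaussian R]_x (f x)%:E)%E.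
Proof.
move=> fint; have mf := measurable_int _ fint.
(* The law of [Z] and [gaussian R] live on two structures of measurable space on
   [R], with the same measurable sets; viewing [Z] as a map to the second one
   makes the two measures comparable. *)
pose Z' : T -> measurableTypeR R := Z.
have mZ : measurable_fun setT Z' by have := @measurable_funPT _ _ _ _ Z.
have mZ' : isMeasurableFun _ _ _ _ Z' := isMeasurableFun.Build _ _ _ _ _ mZ.
pose ZZ : {mfun T >-> measurableTypeR R} := HB.pack Z' mZ'.
have eqm (g : measurableTypeR R -> \bar R) :
    (\int[pushforward P ZZ]_x g x = \int[gaussian R]_x g x)%E.
  by apply: eq_measure_integral => A mA _; exact: Z_std_normal.
have Pint : P.-integrable setT (EFin \o (f \o Z)).
  apply/integrableP; split.
    by apply: (measurableT_comp mf mZ).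
  have /integrableP[_] := fint; apply: le_lt_trans.
  rewrite -eqm ge0_integral_pushforward//.
  exact: measurableT_comp.
by split => //; rewrite -eqm integral_pushforward.
Qed.

End gaussian_moments.

(** The expectation defining [U] is finite, as [G \o F theta] and the identity
    are square integrable; so [fine] identifies no infinite value with 0. *)
Lemma hermite_rank_ge2_U_coef (R : realType) d (T : measurableType d)
    (P : probability T R) (Z : {RV P >-> R})
    (Z_std_normal : forall A : set R, measurable A ->
       distribution P Z A = gaussian R A)
    p (G : R -> R) (F : 'rV[R]_p -> R -> R) theta :
  G \o F theta \in Lfun (gaussian R) 2%:E ->
  (2%:E <= hermite_rank (G \o F theta))%E <-> U_coef P Z G F theta = 0.
Proof.
move=> GF2.
have int : (gaussian R).-integrable setT
    (EFin \o (fun x => (G \o F theta) x * hermite 1 x)).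
  apply/Lfun1_integrable.
  rewrite (_ : (fun x => _) = (G \o F theta) \* (@idfun R)).
    by apply: Lfun2_mul_Lfun1 => //; exact: id_Lfun2_gaussian.
  by apply/funext => x; rewrite hermite1.
have [intP E] := integral_std_normal Z_std_normal int.
rewrite hermite_rank_ge2 /U_coef unlock -E.
have fin := integrable_fin_num measurableT intP.
split=> [-> //|/eqP].
by rewrite fine_eq0// => /eqP.
Qed.

(** * Hermite rank along an analytic family of transformations *)

Theorem theorem2p6 (R : realType) (p : nat) (p_gt0 : (0 < p)%N)
    (d : measure_display) (T : measurableType d) (P : probability T R)
    (Z : {RV P >-> R})
    (Z_std_normal : forall A : set R, measurable A ->
       distribution P Z A = gaussian R A)
    (G : R -> R) (G_L2 : G \in Lfun (gaussian R) 2%:E)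
    (D : set 'rV[R]_p) (D_open : open D) (D_connected : connected D)
    (D_0 : D 0)
    (F : 'rV[R]_p -> R -> R) (F_0 : F 0 = id)
    (GF_L2 : forall theta, D theta -> G \o F theta \in Lfun (gaussian R) 2%:E)
    (U_analytic : real_analytic D (U_coef P Z G F))
    (U_zero_const : (forall theta, D theta -> U_coef P Z G F theta = 0) ->
       const_ae G) :
  let E := [set theta | D theta /\ (2%:E <= hermite_rank (G \o F theta))%E] in
  const_ae G \/
  (~ const_ae G /\
   [/\ E = [set theta | D theta /\ U_coef P Z G F theta = 0],
       (hausdorff_dim E <= (p%:R - 1)%:E)%E
     & lebesgue_outer E = 0%E]).
Proof.
move=> E; have [Gconst|Gnconst] := pselect (const_ae G); first by left.
right; split => //.
have EU : E = [set theta | D theta /\ U_coef P Z G F theta = 0].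
  apply/seteqP; split => theta [Dt]; have := GF_L2 _ Dt.
    by move=> /(hermite_rank_ge2_U_coef Z_std_normal) h /h Ut; split.
  by move=> /(hermite_rank_ge2_U_coef Z_std_normal) h /h Ut; split.
have Un0 : exists2 theta, D theta & U_coef P Z G F theta != 0.
  apply: contrapT => nU; apply: Gnconst; apply: U_zero_const => theta Dt.
  by apply: contrapT => /eqP Ut; apply: nU; exists theta.
case: p p_gt0 D D_open D_connected D_0 F F_0 GF_L2 U_analytic U_zero_const E EU Un0
  => // q _ {}D D_open D_connected _ {}F _ _ U_analytic _ E EU Un0.
have E_null s : q%:R < s -> content_null s E.
  by rewrite EU => qs; exact: real_analytic_zero_set.
split => //; last by apply: content_null_lebesgue; apply: E_null; rewrite ltr_nat.
have -> : q.+1%:R - 1 = q%:R :> R by rewrite -natr1 addrK.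
exact: content_null_hausdorff_dim.
Qed.
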